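(* Let $n>0$ and let $K$ be a finite $n$-dimensional simplicial complex equipped with a tiling $\mathcal{T}$. Then it is possible to pack $h_0(\mathcal{T})+h_1(\mathcal{T})$ disjoint $n$-simplices in $\mathrm{Sd}(K)$. Moreover, this packing can be completed (all simplices of the whole collection being pairwise disjoint) by $$h_{n+1-j}(\mathcal{T})+2^{n-1-j}\sum_{s=0}^{n-1-j}\frac{h_s(\mathcal{T})}{2^s}$$ disjoint $j$-simplices for every $j\in\{0,\ldots,n-1\}$.
   Context: $\mathrm{Sd}(K)$ is the first barycentric subdivision of $K$. A packing in a simplicial complex is a collection of its closed simplices, here required to be pairwise disjoint. For $s\in\{0,\ldots,n+1\}$, a tile of type $T_s^n$ is a closed $n$-simplex deprived of $s$ of its (closed) facets. A tiling $\mathcal{T}$ of an $n$-dimensional simplicial complex $K$ is a partition of $|K|$ into disjoint tiles, each of the form $\sigma$ deprived of $s$ of its facets for some $n$-simplex $\sigma$ of $K$ and some $s\in\{0,\ldots,n+1\}$; $h_s(\mathcal{T})$ is the number of tiles of type $T_s^n$ in $\mathcal{T}$. *)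

(* Defs.v *)
From mathcomp Require Import all_boot all_order all_algebra.
From mathcomp Require Import all_classical all_reals.

Set Implicit Arguments.
Unset Strict Implicit.
Unset Printing Implicit Defensive.

Import Order.TTheory GRing.Theory Num.Theory.

Local Open Scope classical_set_scope.
Local Open Scope ring_scope.

(* A simplex is given by its nonempty set of vertices; not every v : V has to
   be a vertex of the complex. *)
Record simplicial_complex (V : finType) := SimplicialComplex {
  simplices : {set {set V}};
  simplices_neq0 : finset.set0 \notin simplices;
  simplices_face : forall s t : {set V},
    s \in simplices -> t \subset s -> t != finset.set0 -> t \in simplices }.

Definition has_dim (V : finType) (j : nat) (s : {set V}) : bool :=
  #|s| == j.+1.

Definition complex_dim (V : finType) (n : nat) (K : simplicial_complex V) :=
  (\max_(s in simplices K) #|s|)%N = n.+1.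

(* Points of the geometric realization are functions V -> R, their barycentric
   coordinates. *)
Definition closed_simplex (R : realType) (V : finType) (s : {set V}) :
    set (V -> R) :=
  [set x | [/\ forall v, 0 <= x v, \sum_v x v = 1
             & forall v, v \notin s -> x v = 0]].

Definition realization (R : realType) (V : finType) (K : simplicial_complex V) :
    set (V -> R) :=
  \bigcup_(s in [set` simplices K]) @closed_simplex R V s.

Definition facets (V : finType) (s : {set V}) : {set {set V}} :=
  [set (s :\ v)%SET | v in s]%SET.

(* The pair (s, F) encodes the simplex s deprived of the facets in F. *)
Definition tile (V : finType) : finType := ({set V} * {set {set V}})%type.

Definition is_tile (V : finType) (n s : nat) (t : tile V) : bool :=
  [&& has_dim n t.1, t.2 \subset facets t.1 & #|t.2| == s].

Definition tile_points (R : realType) (V : finType) (t : tile V) :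
    set (V -> R) :=
  @closed_simplex R V t.1 `\` \bigcup_(f in [set` t.2]) @closed_simplex R V f.

Definition tiling (R : realType) (V : finType) (n : nat)
    (K : simplicial_complex V) (T : {set tile V}) : Prop :=
  (forall t, t \in T ->
     t.1 \in simplices K /\ exists2 s, (s <= n.+1)%N & is_tile n s t) /\
  classical_sets.partition [set` T] (@tile_points R V) (@realization R V K).

Definition h_number (V : finType) (n : nat) (T : {set tile V}) (s : nat) : nat :=
  #|[set t in T | is_tile n s t]%SET|.

Definition sd_simplices (V : finType) (K : simplicial_complex V) :
    {set {set {set V}}} :=
  [set c : {set {set V}} | [&& c != finset.set0, c \subset simplices K
     & [forall s in c, forall t in c, (s \subset t) || (t \subset s)]]]%SET.

Lemma sd_simplices_neq0 (V : finType) (K : simplicial_complex V) :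
  finset.set0 \notin sd_simplices K.
Proof. by rewrite inE eqxx. Qed.

Lemma sd_simplices_face (V : finType) (K : simplicial_complex V)
    (c d : {set {set V}}) :
  c \in sd_simplices K -> d \subset c -> d != finset.set0 ->
  d \in sd_simplices K.
Proof.
rewrite !inE => /and3P[_ cK /forall_inP cP] dc ->.
rewrite (fintype.subset_trans dc cK) /=.
apply/forall_inP => s sd; apply/forall_inP => t td.
have /forall_inP := cP s (fintype.subsetP dc s sd).
by apply; apply: (fintype.subsetP dc).
Qed.

Definition Sd (V : finType) (K : simplicial_complex V) :
    simplicial_complex {set V} :=
  SimplicialComplex (sd_simplices_neq0 K) (@sd_simplices_face V K).

Definition packing (R : realType) (V : finType) (K : simplicial_complex V)
    (P : {set {set V}}) : Prop :=
  P \subset simplices K /\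
  classical_sets.trivIset [set` P] (@closed_simplex R V).

Definition num_simplices (V : finType) (j : nat) (P : {set {set V}}) : nat :=
  #|[set s in P | has_dim j s]%SET|.

(* Main.v *)
Require Import Defs.
From mathcomp Require Import all_boot all_order all_algebra.
From mathcomp Require Import all_classical all_reals.
From mathcomp Require Import zify.

(** Closed simplices of the barycentric subdivision are disjoint exactly when
    the corresponding chains of simplices of K share no member: a point common
    to two closed simplices has a nonzero barycentric coordinate, and it sits at
    a shared vertex.  So the packing is a purely combinatorial object, a family
    of chains of faces no two of which have a face in common.

    A simplex sigma deprived of the facets opposite to the vertices of
    R contains the barycenters of precisely the nonempty faces s with
    R \subset s \subset sigma ([barycenter_tile_points]).  As the tiles are
    pairwise disjoint, so are these intervals of faces
    ([tile_intervals_disjoint]), and each tile can be treated by itself.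

    For a tile with r missing facets the interval is a Boolean lattice of rank
    m = n + 1 - r, and a Boolean lattice of rank m splits into one maximal
    chain, with m + 1 members, and 2 ^ (m - 1 - k) chains with k members for
    every 0 < k < m ([interval_chains]).  This goes by induction on m: write the
    lattice as two copies of the lattice of rank m - 1, use in each copy the
    same decomposition, and move the top of the upper copy onto the maximal
    chain of the lower one.  If r = 0 the bottom of the lattice is the empty
    set, which is not a face; removing it shortens the maximal chain by one
    ([tile_chains]).  So the maximal chain gives an n-simplex when r is 0 or 1
    and an (n + 1 - r)-simplex otherwise, while the other chains give
    2 ^ (n - 1 - j - r) simplices of dimension j; adding these numbers over the
    tiles yields the two announced counts. *)

Set Implicit Arguments.
Unset Strict Implicit.

(** * Chain decompositions of Boolean intervals *)

Section BooleanIntervals.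
Import boot.fintype boot.finset.
Context {V : finType}.
Implicit Types (A B s : {set V}) (c d M N : {set {set V}}).
Implicit Types D Q : {set {set {set V}}}.

Definition interval A B : {set {set V}} :=
  [set s : {set V} | A \subset s & s \subset B].

Definition is_chain c : bool :=
  [forall s in c, forall t in c, (s \subset t) || (t \subset s)].

Definition num_card k D : nat := #|[set c in D | #|c| == k]|.

(** Pairwise disjointness, in the form that determines a chain by any of its
    members.  Stated this way it says nothing about the empty chain, which the
    induction of [interval_chains] does produce. *)
Definition sharing_free Q : Prop :=
  forall c d s, c \in Q -> d \in Q -> s \in c -> s \in d -> c = d.

Lemma is_chainS c d : c \subset d -> is_chain d -> is_chain c.
Proof.
move=> /subsetP cd /forall_inP dP; apply/forall_inP => s sc.
apply/forall_inP => t tc.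
by have /forall_inP := dP s (cd s sc); apply; exact: cd.
Qed.

(** Families of chains may both contain the empty chain, hence the restriction
    to positive k. *)
Lemma num_cardU k D1 D2 : (0 < k)%N ->
  (forall c s, s \in c -> c \in D1 -> c \in D2 -> False) ->
  num_card k (D1 :|: D2) = (num_card k D1 + num_card k D2)%N.
Proof.
move=> k0 D12; rewrite /num_card -cardsUI [X in (_ + X)%N](_ : _ = 0%N).
  by rewrite addn0; apply: eq_card => c; rewrite !inE andb_orl.
apply/eqP; rewrite cards_eq0 -subset0; apply/subsetP => c.
rewrite !inE => /andP[/andP[c1 /eqP ck] /andP[c2 _]].
have /card_gt0P[s sc] : (0 < #|c|)%N by rewrite ck.
by case: (D12 c s).
Qed.

Lemma num_card1 k c : num_card k [set c] = (#|c| == k).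
Proof.
rewrite /num_card; case: eqP => [ck|ck].
  rewrite (_ : [set d in _ | _] = [set c]) ?cards1//; apply/setP => d.
  by rewrite !inE; case: eqP => //= ->; rewrite ck eqxx.
rewrite (_ : [set d in _ | _] = set0) ?cards0//; apply/setP => d.
by rewrite !inE; case: eqP => //= ->; apply/eqP.
Qed.

Lemma num_card_imset (f : {set {set V}} -> {set {set V}}) k D :
  {in D &, injective f} -> {in D, forall c, #|f c| = #|c|} ->
  num_card k (f @: D) = num_card k D.
Proof.
move=> f_inj fC; rewrite /num_card.
rewrite -[RHS](card_in_imset (f := f)).
  apply: eq_card => d; rewrite !inE; apply/andP/imsetP.
    case=> /imsetP[c cD ->] ck; exists c => //.
    by rewrite inE cD -fC.
  case=> c; rewrite inE => /andP[cD ck] ->.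
  by rewrite imset_f// fC.
by move=> c d; rewrite !inE => /andP[cD _] /andP[dD _]; exact: f_inj.
Qed.

(** By induction on m = |B :\: A|.  Let v be an element of B outside A.  The
    interval [A, B] consists of [A, B :\ v] and of its image under the map
    adding v.  Take a decomposition of the lower half, with maximal chain M, and
    its translate in the upper half, whose maximal chain up M ends at B.  Moving
    B from up M to M gives the new maximal chain and a chain with m - 1 members.
    All other chains are doubled, in accordance with
    2 ^ (m - 1 - k) = 2 * 2 ^ (m - 2 - k). *)
Lemma interval_chains A B : A \subset B ->
  exists M D,
    [/\ [/\ A \in M, B \in M, #|M| = #|B :\: A|.+1 & M \notin D],
        {in M |: D, forall c, c \subset interval A B /\ is_chain c},
        sharing_free (M |: D)
      & forall k, (0 < k)%N -> num_card k D =
          ((k < #|B :\: A|) * 2 ^ (#|B :\: A|.-1 - k))%N].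
Proof.
elim: {B}#|_| {-2}B (erefl #|B :\: A|) => [|m IH] B.
  move=> /eqP; rewrite cards_eq0 setD_eq0 => BA AB.
  have -> : B = A by apply/eqP; rewrite eqEsubset BA.
  exists [set A], set0; rewrite setDv cards0 setU0 cards1 !inE.
  split=> //.
  - move=> c /set1P ->; split.
      by apply/subsetP => s /set1P ->; rewrite inE subxx.
    apply/forall_inP => s /set1P ->; apply/forall_inP => t /set1P ->.
    by rewrite subxx.
  - by move=> c d s /set1P -> /set1P ->.
  - move=> k _; rewrite ltn0 mul0n; apply/eqP; rewrite cards_eq0.
    by apply/eqP/setP => c; rewrite !inE.
move=> cBA AB.
have /card_gt0P[v] : (0 < #|B :\: A|)%N by rewrite cBA.
rewrite inE => /andP[vA vB].
have AB' : A \subset B :\ v by rewrite subsetD1 AB.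
have cB'A : #|(B :\ v) :\: A| = m.
  rewrite (_ : _ :\: A = (B :\: A) :\ v); last first.
    by apply/setP => x; rewrite !inE andbCA.
  by apply/eqP; rewrite -eqSS -cBA [in X in _ == X](cardsD1 v) !inE vA vB.
have [M [D [[AM BM cM MD] QP QU Dk]]] := IH _ cB'A AB'.
rewrite cB'A in cM Dk; rewrite cBA.
set up := fun c : {set {set V}} => [set v |: s | s in c].
pose Q := M |: D; rewrite -/Q in QP QU.
have vQ c s : c \in Q -> s \in c -> v \notin s.
  move=> /QP[/subsetP cI _] /cI; rewrite inE => /andP[_].
  by rewrite subsetD1 => /andP[].
have upE c s : c \in Q -> (s \in up c) = (v \in s) && (s :\ v \in c).
  move=> cQ; apply/imsetP/andP => [[t tc ->]|[vs sc]].
    by rewrite setU11 setU1K// (vQ c).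
  by exists (s :\ v); rewrite // setD1K.
have up_inj : {in Q &, injective up}.
  move=> c d cQ dQ /setP cd; apply/setP => s.
  have [vs|vs] := boolP (v \in s).
    by apply/idP/idP => [/(vQ _ _ cQ)|/(vQ _ _ dQ)]; rewrite vs.
  by have := cd (v |: s); rewrite !upE// setU11 setU1K.
have up_card : {in Q, forall c, #|up c| = #|c|}.
  move=> c cQ; apply: card_in_imset => s t sc tc st.
  by rewrite -(setU1K (vQ _ _ cQ sc)) st setU1K// (vQ c).
have upP : {in Q, forall c, up c \subset interval A B /\ is_chain (up c)}.
  move=> c cQ; have [/subsetP cI /forall_inP cc] := QP c cQ; split.
    apply/subsetP => s; rewrite upE// => /andP[vs /cI].
    rewrite !inE => /andP[As sB]; rewrite (subset_trans As (subD1set _ _)).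
    by rewrite -(setD1K vs) -(setD1K vB) setUS.
  apply/forall_inP => _ /imsetP[s sc ->].
  apply/forall_inP => _ /imsetP[t tc ->].
  by case/orP: (forall_inP (cc s sc) t tc) => st; rewrite (setUS _ st) ?orbT.
have MQ : M \in Q by exact: setU11.
have DQ c : c \in D -> c \in Q by exact: setU1r.
have BupM : B \in up M by rewrite upE// vB.
pose M1 := B |: M; pose N := up M :\ B; pose D1 := N |: (D :|: up @: D).
have BN : B \notin M by apply/negP => /(vQ _ _ MQ); rewrite vB.
(* The chain of the new family through s is a function of s and of the chain d
   of the old family through s :\ v, which is unique: this is why the new family
   is sharing-free.  There is one such function for each half. *)
have Q1v c s : c \in M1 |: D1 -> s \in c -> v \notin s ->
    exists2 d, d \in Q & s \in d /\ (if d == M then c = M1 else c = d).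
  rewrite !inE => /or3P[/eqP->|/eqP->|/orP[cD sc _|]].
  - rewrite inE => /orP[/set1P->|sM _]; first by rewrite vB.
    by exists M; rewrite ?eqxx.
  - by rewrite inE => /andP[_]; rewrite upE// => /andP[->].
  - exists c; rewrite ?DQ//; split=> //; case: eqP => // cM'.
    by rewrite cM' (negPf MD) in cD.
  - by case/imsetP => d dD ->; rewrite upE ?DQ// => /andP[->].
have Q1w c s : c \in M1 |: D1 -> s \in c -> v \in s ->
    exists2 d, d \in Q & s :\ v \in d /\
     (if s == B then c = M1 else if d == M then c = N else c = up d).
  rewrite !inE => /or3P[/eqP->|/eqP->|/orP[cD sc|]].
  - rewrite inE => /orP[/set1P->|sM]; last by move: (vQ _ _ MQ sM) => /negPf->.
    by exists M; rewrite ?eqxx.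
  - rewrite inE => /andP[/[!inE] sB]; rewrite upE// => /andP[_ sM] _.
    by exists M; rewrite ?(negPf sB) ?eqxx.
  - by rewrite (negPf (vQ _ _ (DQ _ cD) sc)).
  - case/imsetP => d dD ->; rewrite upE ?DQ// => /andP[vs sd] _.
    have dM : d != M by apply: contraNneq MD => <-.
    exists d; rewrite ?DQ ?(negPf dM)//; split=> //; case: eqP => // sB.
    by rewrite sB in sd; rewrite (QU _ _ _ (DQ _ dD) MQ sd BM) eqxx in dM.
exists M1, D1; split.
- rewrite !inE AM eqxx orbT cardsU1 BN cM; split=> //.
  rewrite !negb_or; apply/and3P; split; apply/negP.
  + by move=> /eqP/setP/(_ B); rewrite !inE !eqxx.
  + move=> /DQ M1Q; have := vQ M1 B M1Q; rewrite vB !inE eqxx.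
    by move=> /(_ isT).
  + move=> /imsetP[d dD] /setP/(_ A); rewrite upE ?DQ// (negPf vA).
    by rewrite !inE AM orbT.
- have MI := QP M MQ; have IB d : d \subset interval A (B :\ v) ->
      d \subset interval A B.
    move=> /subsetP dI; apply/subsetP => s /dI; rewrite !inE.
    by case/andP => -> /= sB; exact: subset_trans sB (subD1set _ _).
  move=> c; rewrite !inE => /or4P[/eqP->|/eqP->|cD|/imsetP[d dD ->]].
  + have [MI1 /forall_inP MI2] := MI; split.
      by rewrite subUset sub1set inE AB subxx IB.
    have sB s : s \in M -> s \subset B.
      by move=> /(subsetP (IB _ MI1)); rewrite inE => /andP[].
    apply/forall_inP => s /setU1P[->|sM]; apply/forall_inP => t /setU1P[->|tM].
    * by rewrite subxx.
    * by rewrite (sB t) ?orbT.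
    * by rewrite sB.
    * exact: (forall_inP (MI2 s sM)).
  + have [uI uc] := upP M MQ; split; last exact: is_chainS (subD1set _ _) uc.
    exact: subset_trans (subD1set _ _) uI.
  + by have [/IB] := QP c (DQ _ cD).
  + by apply: upP; exact: DQ.
- move=> c d s cQ dQ sc sd; have [vs|vs] := boolP (v \in s).
    have [c' c'Q [sc' cE]] := Q1w _ _ cQ sc vs.
    have [d' d'Q [sd' dE]] := Q1w _ _ dQ sd vs.
    have cd' : c' = d' by exact: QU sc' sd'.
    by rewrite {}cd' in cE; move: cE dE; do 2?case: ifP => _; move=> -> ->.
  have [c' c'Q [sc' cE]] := Q1v _ _ cQ sc vs.
  have [d' d'Q [sd' dE]] := Q1v _ _ dQ sd vs.
  have cd' : c' = d' by exact: QU sc' sd'.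
  by rewrite {}cd' in cE; move: cE dE; case: ifP => _; move=> -> ->.
(* The three parts N, D and up @: D have no nonempty chain in common. *)
- move=> k k0; rewrite !num_cardU//; last 2 first.
  + move=> c s sc cD /imsetP[d dD cE]; move: (sc).
    by rewrite cE upE ?DQ// (negPf (vQ _ _ (DQ _ cD) sc)).
  + move=> c s sc /set1P cN; move: (sc); rewrite cN inE inE => /andP[sB].
    rewrite upE// => /andP[vs sM]; rewrite -cN inE => /orP[cD|].
      by move: (vQ _ _ (DQ _ cD) sc); rewrite vs.
    case/imsetP=> d dD cE; rewrite cE upE ?DQ// in sc.
    case/andP: sc => _ sd; move: MD.
    by rewrite (QU _ _ _ MQ (DQ _ dD) sM sd) dD.
  rewrite num_card1 num_card_imset; last 2 first.
  + by move=> c d cD dD; apply: up_inj; exact: DQ.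
  + by move=> c cD; apply: up_card; exact: DQ.
  have -> : #|N| = m.
    by apply/eqP; rewrite -eqSS -cM -(up_card M MQ) (cardsD1 B (up M)) BupM.
  rewrite Dk//= ltnS; case: (ltngtP k m) => // [km|->]; last first.
    by rewrite subnn.
  have m0 : (0 < m)%N := leq_ltn_trans (leq0n k) km.
  by rewrite !mul1n addnn -mul2n -expnS -subSn ?prednK// -ltnS prednK.
Qed.

End BooleanIntervals.

(** * Tiles as intervals of faces *)

(** The number of chains with k members chosen in a tile with r missing facets;
    the boolean (0 < r) accounts for the empty set, which belongs to the
    interval of faces only if r = 0. *)
Definition num_tile_chains (n r k : nat) : nat :=
  ((k == n.+1 - r + (0 < r)) + (k < n.+1 - r) * 2 ^ (n - r - k))%N.

Section Tiles.
Local Open Scope ring_scope.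
Import boot.fintype boot.finset.
Import Order.TTheory GRing.Theory Num.Theory.
Context {R : realType} {V : finType}.
Implicit Types (s : {set V}) (t : tile V).

(** The vertices opposite to the missing facets: a nonempty face of t.1 has its
    interior in the tile iff it contains all of them. *)
Definition restriction t : {set V} := [set v in t.1 | t.1 :\ v \in t.2].

Lemma card_restriction n r t : is_tile n r t -> #|restriction t| = r.
Proof.
case/and3P => _ /subsetP tF /eqP <-.
rewrite -(@card_in_imset _ _ (fun v => t.1 :\ v)); last first.
  move=> v w; rewrite !inE => /andP[vt _] /andP[wt _] /setP/(_ v).
  by rewrite !inE vt eqxx andbT /=; case: eqP.
apply: eq_card => f; apply/imsetP/idP => [[v]|ft].
  by rewrite inE => /andP[_ ?] ->.
have /imsetP[v vt fE] := tF f ft.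
by exists v => //; rewrite inE vt -fE.
Qed.

Definition barycenter s : V -> R := fun v => if v \in s then #|s|%:R^-1 else 0.

Lemma barycenter_closed_simplex s (u : {set V}) : s != set0 -> s \subset u ->
  @closed_simplex R V u (barycenter s).
Proof.
move=> s0 /subsetP su; split=> [v||v vu].
- by rewrite /barycenter; case: ifP => _; rewrite ?invr_ge0 ?ler0n.
- rewrite -big_mkcond sumr_const -[X in X *+ _]mul1r -mulrnAr -mulr_natr.
  by rewrite mul1r mulVf// pnatr_eq0 cards_eq0.
- by rewrite /barycenter ifN//; apply: contraNN vu => /su.
Qed.

(** Every missing facet omits a vertex of the restriction, where the barycenter
    of s has a positive coordinate. *)
Lemma barycenter_tile_points s t : t.2 \subset facets t.1 ->
  s \in interval (restriction t) t.1 -> s != set0 ->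
  @tile_points R V t (barycenter s).
Proof.
move=> /subsetP tF; rewrite inE => /andP[/subsetP rs st] s0; split.
  exact: barycenter_closed_simplex.
case=> f /= ft [_ _ xf]; have /imsetP[v vt fE] := tF f ft.
have vs : v \in s by apply: rs; rewrite inE vt -fE.
have := xf v; rewrite fE !inE eqxx /= => /(_ isT)/eqP.
by rewrite /barycenter vs invr_eq0 pnatr_eq0 cards_eq0 (negPf s0).
Qed.

Lemma tile_intervals_disjoint n (K : simplicial_complex V) (T : {set tile V})
    t u s : tiling R n K T -> t \in T -> u \in T -> s != set0 ->
  s \in interval (restriction t) t.1 -> s \in interval (restriction u) u.1 ->
  t = u.
Proof.
move=> [tileT [_ tiv _]] tT uT s0 st su; apply: (tiv t u) => //.
have pts w : w \in T -> s \in interval (restriction w) w.1 ->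
    @tile_points R V w (barycenter s).
  move=> wT sw; have [_ [r _ /and3P[_ wF _]]] := tileT w wT.
  exact: barycenter_tile_points.
by exists (barycenter s); split; exact: pts.
Qed.

(** The coordinates of a point sum to 1, so one of them is nonzero; its index is
    a vertex of every closed simplex that contains the point. *)
Lemma sharing_free_packing (K : simplicial_complex V)
    (P : {set {set {set V}}}) :
  P \subset simplices (Sd K) -> sharing_free P -> packing R (Sd K) P.
Proof.
move=> PK PU; split=> // c d /= cP dP [x [[_ x1 xc] [_ _ xd]]].
have [s xs] : exists s, x s != 0.
  apply/not_existsP => x0; move/eqP: x1; rewrite big1 ?(eq_sym 0) ?oner_eq0//.
  by move=> s _; apply/eqP; apply: contrapT => /negP/x0.
apply: (PU c d s) => //.
  by apply: contraNT xs => /xc ->.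
by apply: contraNT xs => /xd ->.
Qed.

(** The chains are those of [interval_chains], from which the empty set is
    removed: it can only be the bottom of the interval, a member of the maximal
    chain M.  The outer removal discards empty chains. *)
Lemma tile_chains n r (K : simplicial_complex V) t :
    is_tile n r t -> t.1 \in simplices K ->
  exists D : {set {set {set V}}},
    [/\ {in D, forall c, [/\ c \in simplices (Sd K), set0 \notin c
                           & c \subset interval (restriction t) t.1]},
        sharing_free D
      & forall k, (0 < k)%N -> num_card k D = num_tile_chains n r k].
Proof.
move=> tr tK; have /and3P[/eqP ct _ _] := tr.
have rt : restriction t \subset t.1.
  by apply/subsetP => v; rewrite inE => /andP[].
have [M [D [[rM tM cM MD] QP QU Dk]]] := interval_chains rt.
have := cardsID (restriction t) t.1.
rewrite (setIidPr rt) (card_restriction tr) ct => cD.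
have {}cD : #|t.1 :\: restriction t| = (n.+1 - r)%N by rewrite -cD addKn.
have r_eq0 : (restriction t == set0) = (r == 0)%N.
  by rewrite -cards_eq0 (card_restriction tr).
have M0 : (set0 \in M) = (r == 0)%N.
  rewrite -r_eq0; apply/idP/eqP => [|<-//].
  have [/subsetP MI _] := QP M (setU11 _ _).
  by move=> /MI; rewrite inE subset0 => /andP[/eqP].
have D0 c : c \in D -> set0 \notin c.
  move=> cD'; have cQ : c \in M |: D by exact: setU1r.
  apply/negP => c0; have [/subsetP cI _] := QP c cQ.
  have : set0 \in M.
    by rewrite M0 -r_eq0; have := cI _ c0; rewrite inE subset0 => /andP[].
  by move=> /(QU _ _ _ cQ (setU11 _ _) c0) cM'; rewrite -cM' cD' in MD.
exists (((M :\ set0) |: D) :\ set0); split.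
- move=> c; rewrite !inE => /andP[c0 cQ].
  have cn : set0 \notin c.
    by case/orP: cQ => [/eqP->|/D0//]; rewrite !inE eqxx.
  have [cI cc] : c \subset interval (restriction t) t.1 /\ is_chain c.
    case/orP: cQ => [/eqP->|cQ]; last by apply: QP; rewrite inE cQ orbT.
    have [MI Mc] := QP M (setU11 _ _).
    split; first exact: subset_trans (subD1set _ _) MI.
    exact: is_chainS (subD1set _ _) Mc.
  split=> //; apply/and3P; split=> //.
  apply/subsetP => s sc; have := subsetP cI s sc; rewrite inE => /andP[_ st].
  apply: (simplices_face tK) => //; apply: contraNneq cn => <-; exact: sc.
- move=> c d s; have QE e : e \in (M :\ set0 |: D) :\ set0 -> s \in e ->
      exists2 e', e' \in M |: D & s \in e' /\
        e = (if e' == M then M :\ set0 else e').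
    rewrite !inE => /andP[_ /orP[/eqP->|eD se]].
      by rewrite !inE => /andP[_ sM]; exists M; rewrite ?setU11 ?eqxx.
    exists e; first exact: setU1r.
    by split=> //; case: eqP => // eM; rewrite -eM eD in MD.
  move=> /QE cE /QE dE /cE[c' c'Q [sc' ->]] /dE[d' d'Q [sd' ->]].
  by rewrite (QU _ _ _ c'Q d'Q sc' sd').
- move=> k k0; rewrite (_ : num_card k _ = num_card k (M :\ set0 |: D)).
    rewrite num_cardU//; last first.
      move=> c s sc /set1P cM' cD'; move: (sc); rewrite cM' !inE => /andP[_ sM].
      by rewrite (QU _ _ _ (setU11 _ _) (setU1r _ cD') sM sc) cD' in MD.
    rewrite num_card1 Dk// cD subSKn /num_tile_chains.
    congr (nat_of_bool _ + _)%N.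
    have := cM; rewrite (cardsD1 set0) M0 cD eq_sym; case: (r) => [|r'] /=.
      by rewrite addn0 add1n => -[->].
    by rewrite add0n addn1 => ->.
  apply: eq_card => c; rewrite !inE; case: eqP => //= ->.
  by rewrite cards0; case: (k) k0 => // k' _; rewrite andbF.
Qed.

End Tiles.

(** * Adding up over the tiles *)

Section Counting.
Local Open Scope ring_scope.
Import boot.fintype boot.finset.
Import Order.TTheory GRing.Theory Num.Theory.

Lemma num_card_bigcup (I V : finType) (A : {set I})
    (D : I -> {set {set {set V}}}) k : (0 < k)%N ->
  (forall i j c s, i \in A -> j \in A -> c \in D i -> c \in D j -> s \in c ->
     i = j) ->
  num_card k (\bigcup_(i in A) D i) = (\sum_(i in A) num_card k (D i))%N.
Proof.
move=> k0 DU; pose F i := [set c in D i | (i \in A) && (#|c| == k)].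
rewrite /num_card (_ : [set c in _ | _] = \bigcup_i F i); last first.
  apply/setP => c; rewrite inE; apply/andP/bigcupP.
    by case=> /bigcupP[i iA ci] ck; exists i; rewrite // inE ci iA.
  case=> i _; rewrite inE => /and3P[ci iA ck]; split=> //.
  by apply/bigcupP; exists i.
rewrite -sum1_card partition_disjoint_bigcup; last first.
  move=> i j; apply: contraNT => /pred0Pn[c /=]; rewrite !inE.
  case/andP=> /and3P[ci iA ck] /and3P[cj jA _].
  have /card_gt0P[s sc] : (0 < #|c|)%N by rewrite (eqP ck).
  by apply/eqP; exact: DU sc.
rewrite [RHS]big_mkcond; apply: eq_bigr => i _; rewrite sum1_card.
case: ifP => iA; first by apply: eq_card => c; rewrite !inE iA.
by apply/eqP; rewrite cards_eq0; apply/eqP/setP => c; rewrite !inE iA andbF.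
Qed.

Lemma h_numberE (V : finType) n (T : {set tile V}) r :
  (forall t, t \in T -> is_tile n #|t.2| t) ->
  h_number n T r = (\sum_(t in T) (#|t.2| == r))%N.
Proof.
move=> tileT; rewrite /h_number -sum1_card big_mkcond [RHS]big_mkcond.
apply: eq_bigr => t _; rewrite inE; case: (boolP (t \in T)) => //= tT.
by have /and3P[t1 t2 _] := tileT t tT; rewrite /is_tile t1 t2; case: eqP.
Qed.

(** Both sides are sums over the tiles.  On the right a tile with r missing
    facets contributes 1 if r = n + 1 - j, which is its maximal chain, and
    2 ^ (n - 1 - j) / 2 ^ r, from the index s = r alone, if r < n - j, which
    counts its other chains. *)
Lemma sum_num_tile_chains (R : realType) (V : finType) n (T : {set tile V}) j :
    (forall t, t \in T -> is_tile n #|t.2| t) ->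
    (forall t, t \in T -> (#|t.2| <= n.+1)%N) -> (j < n)%N ->
  (\sum_(t in T) num_tile_chains n #|t.2| j.+1)%N%:R =
  (h_number n T (n + 1 - j))%:R +
  2%:R ^+ (n - 1 - j) *
  \sum_(s < (n - 1 - j).+1) (h_number n T s)%:R / 2%:R ^+ s :> R.
Proof.
move=> tileT rT jn.
rewrite h_numberE// !natr_sum mulr_sumr.
transitivity (\sum_(t in T) (((#|t.2| == n + 1 - j)%N : nat)%:R +
  \sum_(s < (n - 1 - j).+1) 2%:R ^+ (n - 1 - j) *
     (((#|t.2| == s) : nat)%:R / 2%:R ^+ s)) : R).
  apply: eq_bigr => t /rT; move: #|t.2| => r rn.
  rewrite /num_tile_chains natrD; congr (_ + _).
    by congr (nat_of_bool _)%:R; case: r rn => [|r]; lia.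
  have [rj|rj] := ltnP r (n - 1 - j).+1.
    rewrite (bigD1 (Ordinal rj)) //= big1 ?addr0; last first.
      move=> s /eqP sr; case: eqP => rs; last by rewrite mul0r mulr0.
      by case: sr; apply: val_inj.
    rewrite eqxx mul1r (_ : (_ < _)%N = true); last by lia.
    rewrite mul1n natrX -expfB_cond ?pnatr_eq0//.
    by congr (_ ^+ _); lia.
  rewrite big1 => [|s _]; last first.
    case: eqP => rs; last by rewrite mul0r mulr0.
    by have := ltn_ord s; rewrite -rs ltnNge rj.
  by rewrite (_ : (_ < _)%N = false) ?mul0n//; lia.
rewrite big_split exchange_big /=; congr (_ + _).
by apply: eq_bigr => s _; rewrite h_numberE// natr_sum mulr_suml mulr_sumr.
Qed.

End Counting.

Local Open Scope ring_scope.

Theorem theorem1p12 (R : realType) (V : finType) (n : nat)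
    (K : simplicial_complex V) (T : {set tile V})
    (n_gt0 : (0 < n)%N) (dimK : complex_dim n K) (tilT : tiling R n K T) :
  exists P : {set {set {set V}}},
    [/\ packing R (Sd K) P,
        num_simplices n P = (h_number n T 0 + h_number n T 1)%N
      & forall j : nat, (j <= n.-1)%N ->
          (num_simplices j P)%:R =
          (h_number n T (n + 1 - j))%:R +
          2%:R ^+ (n - 1 - j) *
          \sum_(s < (n - 1 - j).+1) (h_number n T s)%:R / 2%:R ^+ s :> R].
Proof.
have tileT t : t \in T -> is_tile n #|t.2| t /\ t.1 \in simplices K.
  move=> tT; have [tK [r _ tr]] := tilT.1 t tT; split=> //.
  by have /and3P[_ _ /eqP->] := tr.
have rT t : t \in T -> (#|t.2| <= n.+1)%N.
  by move=> tT; have [_ [r rn /and3P[_ _ /eqP->]]] := tilT.1 t tT.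
have hE := h_numberE _ (fun t tT => (tileT t tT).1).
have /boolp.choice[D DP] : forall t, exists D : {set {set {set V}}}, t \in T ->
    [/\ {in D, forall c, [/\ c \in simplices (Sd K), finset.set0 \notin c
                         & c \subset interval (restriction t) t.1]},
        sharing_free D
      & forall k, (0 < k)%N -> num_card k D = num_tile_chains n #|t.2| k].
  move=> t; have [tT|tT] := boolP (t \in T).
    by have [tr tK] := tileT t tT; have [D DP] := tile_chains tr tK; exists D.
  by exists finset.set0.
have DU t u c d s : t \in T -> u \in T -> c \in D t -> d \in D u ->
    s \in c -> s \in d -> t = u.
  move=> tT uT ct du sc sd.
  have [/(_ c ct)[_ c0 /fintype.subsetP cI] _ _] := DP t tT.
  have [/(_ d du)[_ _ /fintype.subsetP dI] _ _] := DP u uT.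
  apply: (tile_intervals_disjoint tilT tT uT _ (cI s sc) (dI s sd)).
  by apply: contraNneq c0 => <-.
exists (\bigcup_(t in T) D t)%SET.
have countP j : num_simplices j (\bigcup_(t in T) D t)%SET =
    (\sum_(t in T) num_tile_chains n #|t.2| j.+1)%N.
  transitivity (num_card j.+1 (\bigcup_(t in T) D t)%SET) => //.
  rewrite num_card_bigcup//.
    by apply: eq_bigr => t tT; have [_ _ ->] := DP t tT.
  by move=> t u c s tT uT ct cu sc; exact: (DU _ _ _ _ _ tT uT ct cu sc sc).
split.
- apply: sharing_free_packing.
    apply/fintype.subsetP => c /bigcupP[t tT ct].
    by have [/(_ c ct)[]] := DP t tT.
  move=> c d s /bigcupP[t tT ct] /bigcupP[u uT du] sc sd.
  have tu := DU _ _ _ _ _ tT uT ct du sc sd; rewrite -{}tu in du.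
  by have [_ DU' _] := DP t tT; exact: DU' sc sd.
- rewrite countP !hE -big_split; apply: eq_bigr => t tT /=.
  rewrite /num_tile_chains.
  by move: #|t.2| => [|[|r]]; lia.
- move=> j jn; have {}jn : (j < n)%N by rewrite -(prednK n_gt0) ltnS.
  by rewrite countP; apply: sum_num_tile_chains => // t /tileT[].
Qed.
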